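(* Let $\chi=(\chi_0,\dots,\chi_n)$ be a weight vector, let $Q(\chi)=\{p_1,\dots,p_m\}$ be the set of primes dividing at least one $\chi_j$, and let ${}_{p_i}\chi$ denote the $p_i$-content of $\chi$. (a) $\mathbb{P}(\chi)$ is homeomorphic to the limit, in topological spaces, of the diagram consisting of the $m$ maps $$e(1/{}_{p_i}\chi)\colon \mathbb{P}({}_{p_i}\chi)\longrightarrow\mathbb{C}P^n\qquad(1\leq i\leq m)$$ with common target $\mathbb{C}P^n$; and the associated universal maps $\mathbb{P}(\chi)\to\mathbb{P}({}_{p_i}\chi)$ may be identified with $e({}_{p_i}\chi/\chi)$ for every $1\leq i\leq m$. (b) $\mathbb{P}(\chi)$ is homeomorphic to the colimit, in topological spaces, of the diagram consisting of the $m$ maps $$e({}_{p_i}\chi)\colon \mathbb{C}P^n\longrightarrow\mathbb{P}({}_{p_i}\chi)\qquad(1\leq i\leq m)$$ with common source $\mathbb{C}P^n$; and the associated universal maps $\mathbb{P}({}_{p_i}\chi)\to\mathbb{P}(\chi)$ may be identified with $e(\chi/{}_{p_i}\chi)$ for every $1\leq i\leq m$.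
   Context: A weight vector is an element $\chi=(\chi_0,\dots,\chi_n)$ of $\mathbb{N}^{n+1}$ with all $\chi_j$ positive; weight vectors are multiplied coordinatewise and $1=(1,\dots,1)$. The weighted projective space $\mathbb{P}(\chi)$ is the orbit space of $S^{2n+1}\subset\mathbb{C}^{n+1}$ under the action $t\cdot(z_0,\dots,z_n)=(t^{\chi_0}z_0,\dots,t^{\chi_n}z_n)$ of the unit circle $T$; equivalently it is the quotient of $\mathbb{C}^{n+1}\setminus\{0\}$ by the action of $\lambda\in\mathbb{C}^\times$ given by $(\lambda^{\chi_0}z_0,\dots,\lambda^{\chi_n}z_n)$, so that any nonzero tuple represents a point $[z_0,\dots,z_n]$. In particular $\mathbb{P}(1)=\mathbb{C}P^n$. For weight vectors $\chi,\omega$ of the same length, let $s=s(\chi,\omega)$ be the smallest positive integer such that $\omega_j$ divides $s\chi_j$ for all $j$, and let $e(\chi/\omega)\colon\mathbb{P}(\omega)\to\mathbb{P}(\chi)$ be the map $[z_0,\dots,z_n]\mapsto[z_0^{s\chi_0/\omega_0},\dots,z_n^{s\chi_n/\omega_n}]$. Then $e(\sigma)\colon\mathbb{C}P^n\to\mathbb{P}(\sigma)$ is the map $[z_j]\mapsto[z_j^{\sigma_j}]$, and $e(1/\sigma)\colon\mathbb{P}(\sigma)\to\mathbb{C}P^n$ is the map $[z_j]\mapsto[z_j^{l(\sigma)/\sigma_j}]$, where $l(\sigma)=\mathrm{lcm}(\sigma_0,\dots,\sigma_n)$. For a prime $p$, the $p$-content of $\chi$ is the weight vector ${}_p\chi=(p^{a(0)},\dots,p^{a(n)})$,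 where $p^{a(j)}$ is the largest power of $p$ dividing $\chi_j$. *)

(* Defs.v *)
From HB Require Import structures.
From mathcomp Require Import all_boot all_order all_algebra.
From mathcomp Require Import generic_quotient complex.
From mathcomp Require Import boolp classical_sets functions reals topology.
From mathcomp Require Import normedtype.

Set Implicit Arguments.
Unset Strict Implicit.
Unset Printing Implicit Defensive.

Import Order.TTheory GRing.Theory Num.Theory.
Import numFieldNormedType.Exports.

Local Open Scope quotient_scope.
Local Open Scope classical_set_scope.
Local Open Scope ring_scope.

Section Topology.

Definition homeomorphism (X Y : topologicalType) (h : X -> Y) : Prop :=
  continuous h /\
  exists g : Y -> X, [/\ continuous g, cancel h g & cancel g h].

Variables (I : Type) (X : I -> topologicalType) (Y : topologicalType).

(* The vertex [Y] belongs to the diagrams [X i --f i--> Y] and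
   [Y --f i--> X i], so that cones and cocones also have a leg at [Y]; this
   matters when [I] is empty. *)

Record is_cone (f : forall i, X i -> Y) (L : topologicalType)
    (pr : forall i, L -> X i) (pr0 : L -> Y) : Prop := IsCone {
  cone_cts : forall i, continuous (pr i) ;
  cone_cts0 : continuous pr0 ;
  cone_comm : forall i, f i \o pr i =1 pr0 }.

Definition is_limit (f : forall i, X i -> Y) (L : topologicalType)
    (pr : forall i, L -> X i) (pr0 : L -> Y) : Prop :=
  is_cone f pr pr0 /\
  forall (Z : topologicalType) (q : forall i, Z -> X i) (q0 : Z -> Y),
    is_cone f q q0 ->
    exists! u : Z -> L,
      [/\ continuous u, forall i, pr i \o u =1 q i & pr0 \o u =1 q0].

Record is_cocone (f : forall i, Y -> X i) (C : topologicalType)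
    (inj : forall i, X i -> C) (inj0 : Y -> C) : Prop := IsCocone {
  cocone_cts : forall i, continuous (inj i) ;
  cocone_cts0 : continuous inj0 ;
  cocone_comm : forall i, inj i \o f i =1 inj0 }.

Definition is_colimit (f : forall i, Y -> X i) (C : topologicalType)
    (inj : forall i, X i -> C) (inj0 : Y -> C) : Prop :=
  is_cocone f inj inj0 /\
  forall (Z : topologicalType) (q : forall i, X i -> Z) (q0 : Y -> Z),
    is_cocone f q q0 ->
    exists! u : C -> Z,
      [/\ continuous u, forall i, u \o inj i =1 q i & u \o inj0 =1 q0].

End Topology.

Section Weights.
Local Open Scope nat_scope.

Record weight (n : nat) := Weight {
  wt :> 'I_n.+1 -> nat ;
  wt_gt0 : forall j, 0 < wt j }.

Variable n : nat.
Implicit Types chi omega : weight n.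

Definition wone : weight n := @Weight n (fun=> 1) (fun=> isT).

Lemma pcontent_subproof p chi j : 0 < p ^ logn p (chi j).
Proof. by rewrite -p_part part_gt0. Qed.

Definition pcontent p chi : weight n := Weight (pcontent_subproof p chi).

Definition weight_primes chi : set nat :=
  [set q | prime q /\ exists j, q %| chi j].

Lemma wscale_subproof chi omega :
  exists s, (0 < s) && [forall j, omega j %| s * chi j].
Proof.
exists (\prod_j omega j); rewrite prodn_gt0 => [|j]; last exact: wt_gt0.
by apply/forallP => j; rewrite dvdn_mulr// (bigD1 j)//= dvdn_mulr.
Qed.

(* s(chi, omega) *)
Definition wscale chi omega : nat := ex_minn (wscale_subproof chi omega).

Lemma wscale_gt0 chi omega : 0 < wscale chi omega.
Proof. by rewrite /wscale; case: ex_minnP => s /andP[]. Qed.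

Lemma wscale_dvd chi omega j : omega j %| wscale chi omega * chi j.
Proof. by rewrite /wscale; case: ex_minnP => s /andP[_ /forallP]. Qed.

Definition wexp chi omega (j : 'I_n.+1) : nat :=
  (wscale chi omega * chi j) %/ omega j.

Lemma wexp_gt0 chi omega j : 0 < wexp chi omega j.
Proof.
rewrite divn_gt0 ?wt_gt0// dvdn_leq ?wscale_dvd//.
by rewrite muln_gt0 wscale_gt0 wt_gt0.
Qed.

Lemma wexpK chi omega j :
  omega j * wexp chi omega j = wscale chi omega * chi j.
Proof. by rewrite mulnC divnK// wscale_dvd. Qed.

(* The exponents of e(sigma) and e(1/sigma). *)

Lemma wexp_one_r sigma j : wexp sigma wone j = sigma j.
Proof.
rewrite /wexp divn1; suff -> : wscale sigma wone = 1 by rewrite mul1n.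
rewrite /wscale; case: ex_minnP => s /andP[s0 _] smin.
by apply/eqP; rewrite eqn_leq s0 smin//; apply/forallP => i; exact: dvd1n.
Qed.

Lemma wexp_one_l sigma j :
  wexp wone sigma j = (\big[lcmn/1]_i sigma i) %/ sigma j.
Proof.
rewrite /wexp muln1; congr (_ %/ _); rewrite /wscale.
case: ex_minnP => s /andP[s0 /forallP sP] smin.
have lcms : \big[lcmn/1]_i sigma i %| s.
  by apply/dvdn_biglcmP => i _; have := sP i; rewrite muln1.
apply/eqP; rewrite eqn_leq (dvdn_leq s0 lcms) andbT.
apply: smin; rewrite (dvdn_gt0 s0 lcms) /=.
by apply/forallP => i; rewrite muln1 (biglcmn_sup i).
Qed.

End Weights.

(* The topology of a [numClosedFieldType] is that of its norm, here the
   complex modulus. *)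
Definition CC (R : realType) : numClosedFieldType := R[i].

Section WeightedProjectiveSpace.
Variables (R : realType) (n : nat).
Implicit Types chi omega : weight n.

(* C^{n+1} \ {0}, which as a [set_type] carries the subspace topology *)
Definition nonzero_vectors : set 'rV[CC R]_n.+1 := [set z | z != 0].

Local Notation V := (set_type nonzero_vectors).

Definition wps_rel chi (z w : V) : bool :=
  `[< exists2 l : CC R, l != 0 &
        forall j, set_val w 0 j = l ^+ chi j * set_val z 0 j >].

Lemma wps_rel_refl chi : reflexive (wps_rel chi).
Proof.
move=> z; apply/asboolP; exists 1; last by move=> j; rewrite expr1n mul1r.
exact: oner_neq0.
Qed.

Lemma wps_rel_sym chi : symmetric (wps_rel chi).
Proof.
suff H z w : wps_rel chi z w -> wps_rel chi w z by move=> z w; apply/idP/idP; exact: H.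
move=> /asboolP[l l0 zw]; apply/asboolP; exists l^-1; first by rewrite invr_eq0.
by move=> j; rewrite zw exprVn mulrA mulVf ?mul1r// expf_neq0.
Qed.

Lemma wps_rel_trans chi : transitive (wps_rel chi).
Proof.
move=> y x z /asboolP[l l0 xy] /asboolP[k k0 yz].
apply/asboolP; exists (k * l); first exact: mulf_neq0.
by move=> j; rewrite yz xy exprMn mulrA.
Qed.

Canonical wps_equiv chi : equiv_rel V :=
  EquivRel (wps_rel chi) (@wps_rel_refl chi) (@wps_rel_sym chi)
    (@wps_rel_trans chi).

(* P(chi), with the quotient topology *)
Definition wps chi : topologicalType :=
  quotient_topology {eq_quot wps_equiv chi}.

Definition wps_class chi (z : V) : wps chi :=
  \pi_(quotient_topology {eq_quot wps_equiv chi}) z.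

Lemma wexp_nonzero chi omega (z : V) :
  (\row_j (set_val z 0 j ^+ wexp chi omega j)) \in nonzero_vectors.
Proof.
apply/mem_set; have /= := set_valP z; apply: contra_neq => /rowP zE.
by apply/rowP => j; have /eqP := zE j; rewrite !mxE expf_eq0 wexp_gt0 => /eqP.
Qed.

Definition wps_pow chi omega (z : V) : V := SigSub (wexp_nonzero chi omega z).

(* e(chi/omega); see [wps_mapE] for its value at [z_0, ..., z_n] *)
Definition wps_map chi omega (x : wps omega) : wps chi :=
  wps_class chi (wps_pow chi omega (repr x)).

Lemma wps_mapE chi omega (z : V) :
  wps_map chi (wps_class omega z) = wps_class chi (wps_pow chi omega z).
Proof.
have /eqquotP/asboolP[l l0 zl] : wps_class omega (repr (wps_class omega z))
    = wps_class omega z by rewrite /wps_class reprK.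
apply/eqquotP/asboolP; exists (l ^+ wscale chi omega); first exact: expf_neq0.
by move=> j; rewrite !set_valE /= !mxE zl exprMn -!exprM wexpK.
Qed.

Lemma exprn_cts (K : numFieldType) k : continuous (fun x : K => x ^+ k).
Proof.
elim: k => [|k IH]; first exact: cst_continuous.
rewrite (_ : _^~ _ = fun y : K => y * y ^+ k).
  by move=> x; apply: (@continuousM K K id) => //; exact: IH.
by apply/funext => y; exact: exprS.
Qed.

Lemma wps_map_continuous chi omega : continuous (@wps_map chi omega).
Proof.
apply/quotient_continuous => /=.
rewrite (_ : _ \o _ = wps_class chi \o wps_pow chi omega); last first.
  by apply/funext => z /=; rewrite -wps_mapE.
move=> z; apply: continuous_comp; last exact: pi_continuous.
apply: continuous_comp_initial => {}z A [P Pz PA].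
have pow_cts j k : (fun w : V => set_val w 0 j ^+ k) @ z --> set_val z 0 j ^+ k.
  apply: (@continuous_comp _ _ _ _ (fun x : CC R => x ^+ k)).
    apply: (@continuous_comp _ _ _ set_val (fun M : 'rV_n.+1 => M 0 j)).
      exact: initial_continuous.
    exact: coord_continuous.
  exact: exprn_cts.
rewrite nbhs_simpl /=; near=> w; apply: PA => i j; rewrite !ord1 mxE.
move: i j; near: w; apply: filter_forall => i; apply: filter_forall => j.
by apply: pow_cts; have := Pz i j; rewrite /= !ord1 mxE.
Unshelve. all: by end_near. Qed.

End WeightedProjectiveSpace.

Arguments wps_map R {n} chi omega x.

(* Main.v *)
Require Import Defs.
From mathcomp Require Import all_boot all_order all_algebra.
From mathcomp Require Import boolp classical_sets functions reals topology.
From mathcomp Require Import generic_quotient complex normedtype.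

(** Each P(omega) is compact and Hausdorff. A continuous bijection from the
compact P(chi) onto the limit of Hausdorff spaces is a homeomorphism, and the
surjection e(chi) from CP^n onto P(chi) is closed, hence a quotient map; so
both parts reduce to statements about points.

For the limit, put s_p = s(_p chi, chi) and s_1 = s(1, chi) = l(chi). These
numbers have no common prime factor, whence integers c_i with
sum_i c_i s_(p_i) + c_0 s_1 = 1. If z and w have the same images, then
(w_j / z_j)^(s_p) = l_p^(chi_j) for some scalars l_p, and
w_j / z_j = (prod_p l_p^(c_p))^(chi_j), so [z] = [w]. The same combination of
exponents glues a compatible family of points, once representatives are chosen
with exactly equal images in C^(n+1).

For the colimit, e(chi)[z] = e(chi)[w] means, after rescaling, that
z_j^(chi_j) = w_j^(chi_j) for all j; by the Chinese remainder theorem z and w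
are joined by a chain that alters one p-primary root of unity at a time. *)

Set Implicit Arguments.
Unset Strict Implicit.
Unset Printing Implicit Defensive.

Import Order.TTheory GRing.Theory Num.Theory.
Import numFieldNormedType.Exports.

(** * Arithmetic of the scalings s(chi, omega) and of the exponents of the maps e *)

Section Arithmetic.
Local Open Scope nat_scope.

Lemma bezout_family (I : finType) (a : I -> nat) :
    (forall q, prime q -> exists i, ~~ (q %| a i)) ->
  exists c : I -> int, (\sum_i c i * (a i)%:Z = 1)%R.
Proof.
move=> aP.
have [c cE] : exists c : I -> int,
    (\sum_i c i * (a i)%:Z = (\big[gcdn/0%N]_i a i)%:Z)%R.
  elim: index_enum (index_enum_uniq I) => [_|i r IH /=/andP[ir /IH[c cE]]].
    by exists (fun=> 0%R); rewrite !big_nil.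
  have [u [v uv]] := Bezoutz (a i) (\big[gcdn/0]_(k <- r) a k).
  exists (fun k => if k == i then u else (v * c k)%R).
  rewrite !big_cons eqxx -[RHS]/(gcdz (a i) (\big[gcdn/0]_(k <- r) a k)).
  rewrite -uv -cE; congr (_ + _)%R.
  rewrite mulr_sumr !big_seq; apply: eq_bigr => k kr.
  by rewrite mulrA; case: eqP => // ki; rewrite -ki kr in ir.
exists c; rewrite cE; congr (Posz _); apply/eqP/negPn/negP => g1.
have [|q q_pr qg] := pdivP (n := \big[gcdn/0]_i a i); last first.
  have [i /negP[]] := aP q q_pr; apply: dvdn_trans qg _.
  by rewrite (bigD1 i)//= dvdn_gcdl.
rewrite ltn_neqAle eq_sym g1 /= lt0n; apply/eqP => g0.
(* A zero gcd would make every [a i] zero, hence divisible by 2. *)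
have [i /negP[]] := aP 2 isT.
suff : \big[gcdn/0]_i a i %| a i by rewrite g0 dvd0n => /eqP ->.
by rewrite (bigD1 i)//= dvdn_gcdl.
Qed.

Section Weights.
Variable n : nat.
Implicit Types chi omega : weight n.

Lemma weight_eq chi omega : chi =1 omega -> chi = omega.
Proof.
case: chi omega => [f f0] [g g0] /= /funext fg; subst g.
by congr Weight; exact: Prop_irrelevance.
Qed.

(** The remainder of an admissible [s] modulo the least admissible scaling is again admissible, so
    by minimality it vanishes. *)
Lemma wscale_dvdn chi omega s :
  (forall j, omega j %| s * chi j) -> wscale chi omega %| s.
Proof.
move=> sP; have := wscale_dvd chi omega; have := wscale_gt0 chi omega.
rewrite /wscale; case: ex_minnP => t _ tmin t0 tP.
rewrite /dvdn; case: posnP => // r0.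
suff : t <= s %% t by rewrite leqNgt ltn_pmod.
apply: tmin; rewrite r0; apply/forallP => j.
have := sP j; rewrite {1}(divn_eq s t) mulnDl dvdn_addr// -mulnA.
by rewrite dvdn_mull.
Qed.

Lemma wscale_eq1 chi omega :
  (forall j, omega j %| chi j) -> wscale chi omega = 1.
Proof.
by move=> d; apply/eqP; rewrite -dvdn1 wscale_dvdn// => j; rewrite mul1n.
Qed.

Lemma pcontentE p chi j : pcontent p chi j = (chi j)`_p.
Proof. by rewrite p_part. Qed.

Lemma pcontent1 chi : pcontent 1 chi = wone n.
Proof. by apply: weight_eq => j /=; rewrite exp1n. Qed.

Lemma pcontent_dvd p chi j : pcontent p chi j %| chi j.
Proof. by rewrite pcontentE dvdn_part. Qed.

Lemma dvd_wscale_wone chi j : chi j %| wscale (wone n) chi.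
Proof. by have := wscale_dvd (wone n) chi j; rewrite muln1. Qed.

Section Content.
Variables (p : nat) (chi : weight n).
Let L := wscale (wone n) chi.

(** Only the prime-to-p part of each weight has to be cleared, and it divides the prime-to-p part of
    the lcm [L]. *)
Lemma wscale_pcontent_dvd : wscale (pcontent p chi) chi %| L`_p^'.
Proof.
apply: wscale_dvdn => j; rewrite pcontentE -{1}(partnC p (wt_gt0 chi j)) mulnC.
by rewrite dvdn_mul// partn_dvd ?wscale_gt0 ?dvd_wscale_wone.
Qed.

Lemma wscale_wone_pcontent_dvd : wscale (wone n) (pcontent p chi) %| L`_p.
Proof.
apply: wscale_dvdn => j; rewrite muln1 pcontentE.
by rewrite partn_dvd ?wscale_gt0 ?dvd_wscale_wone.
Qed.

Lemma wscale_pcontentM :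
  wscale (pcontent p chi) chi * wscale (wone n) (pcontent p chi) = L.
Proof.
apply/eqP; rewrite eqn_dvd; apply/andP; split.
  rewrite -[X in _ %| X](partnC p (wscale_gt0 (wone n) chi)) mulnC.
  by rewrite dvdn_mul ?wscale_wone_pcontent_dvd ?wscale_pcontent_dvd.
(* Conversely the product is a common multiple of the weights, while [L] is their lcm. *)
apply: wscale_dvdn => j; rewrite muln1.
apply: dvdn_trans (wscale_dvd (pcontent p chi) chi j) _.
by rewrite dvdn_mul ?dvd_wscale_wone.
Qed.

Lemma wexp_pcontentM j :
  wexp (pcontent p chi) chi j * wexp (wone n) (pcontent p chi) j =
  wexp (wone n) chi j.
Proof.
apply/eqP; rewrite -(eqn_pmul2l (wt_gt0 chi j)) mulnA !wexpK -mulnA wexpK.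
by rewrite mulnA wscale_pcontentM.
Qed.

(** The right side does not depend on [j], so one choice of Bezout coefficients for the scalings
    serves all coordinates. *)
Lemma wexp_pcontent_cofactor j :
  wexp (pcontent p chi) chi j * (chi j %/ pcontent p chi j) =
  wscale (pcontent p chi) chi.
Proof.
apply/eqP; rewrite -(eqn_pmul2r (wt_gt0 (pcontent p chi) j)) -mulnA.
by rewrite divnK ?pcontent_dvd// mulnC wexpK.
Qed.

Lemma prime_ndvd_wscale_pcontent :
  prime p -> ~~ (p %| wscale (pcontent p chi) chi).
Proof.
move=> p_pr; apply/negP => /dvdn_trans/(_ wscale_pcontent_dvd) pL.
by have := part_pnat p^' L; rewrite p'natE// pL.
Qed.

Lemma wexp_pcontent_r j :
  wexp chi (pcontent p chi) j = chi j %/ pcontent p chi j.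
Proof. by rewrite /wexp wscale_eq1 ?mul1n// => k; exact: pcontent_dvd. Qed.

End Content.

(** The two exponents divide the [p]-part and the [q]-part of l(chi). *)
Lemma coprime_wexp_pcontent p q chi j : p != q ->
  coprime (wexp (wone n) (pcontent p chi) j) (wexp (wone n) (pcontent q chi) j).
Proof.
move=> pq; have H (r : nat) : r.-nat (wexp (wone n) (pcontent r chi) j).
  apply: (@pnat_dvd _ (wscale (wone n) chi)`_r); last exact: part_pnat.
  apply: dvdn_trans (wscale_wone_pcontent_dvd r chi).
  by apply/dvdnP; exists (pcontent r chi j); rewrite wexpK muln1.
apply: (@pnat_coprime p); first exact: H.
apply: sub_in_pnat (H q) => r _; rewrite !inE => /eqP ->.
by rewrite eq_sym.
Qed.

Lemma prime_dvd_wscale_wone chi q : prime q -> q %| wscale (wone n) chi ->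
  exists j, q %| chi j.
Proof.
move=> q_pr /dvdn_trans/(_ (wscale_dvdn _)) => /(_ (\prod_j chi j)).
have H : forall j, chi j %| (\prod_j chi j) * wone n j.
  by move=> j; rewrite muln1 (bigD1 j)//= dvdn_mulr.
move/(_ H); rewrite Euclid_dvd_prod// big_has => /hasP[j _ qj]; by exists j.
Qed.

Lemma wexpxx chi j : wexp chi chi j = 1.
Proof. by rewrite /wexp wscale_eq1// mul1n divnn wt_gt0. Qed.

End Weights.
End Arithmetic.

(** * Powers and roots in a field *)

Section Roots.
Variable F : fieldType.
Local Open Scope ring_scope.

Lemma expfz_sum (I : finType) (r : F) (c : I -> int) :
  r != 0 -> r ^ (\sum_i c i) = \prod_i r ^ c i.
Proof.
move=> r0; apply: (big_morph (fun k : int => r ^ k)) => // a b.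
exact: expfzDr.
Qed.

Section Bezout.
Variables (I : finType) (a : I -> nat) (c : I -> int).
Hypothesis ac : \sum_i c i * (a i)%:Z = 1.

(** Write [r] as [r] to the power [\sum_i c i * a i] and regroup. The base found on the right
    depends neither on [r] nor on [k], so it can serve all coordinates at once. *)
Lemma common_exponent (l : I -> F) (r : F) k :
    r != 0 -> (forall i, r ^+ a i = l i ^+ k) ->
  r = (\prod_i l i ^ c i) ^+ k.
Proof.
move=> r0 rl; rewrite -[LHS]expr1z -ac expfz_sum// -prodrXl.
apply: eq_bigr => i _; rewrite mulrC -exprz_exp -exprnP rl exprnP.
by rewrite exprz_exp mulrC -exprz_exp.
Qed.

Lemma common_root (d : I -> nat) (e : nat) (z : I -> F) (y : F) :
    (0 < e)%N -> (forall i, a i * d i = e)%N ->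
    (forall i k, i != k -> coprime (d i) (d k)) ->
    (forall i, z i ^+ d i = y) ->
  exists w, forall i, w ^+ a i = z i.
Proof.
move=> e0 ade cod zy.
have ad0 i : (0 < a i)%N && (0 < d i)%N by rewrite -muln_gt0 ade.
(* The exponents [c i] may be negative, so zero is treated apart. *)
have [y0|y0] := eqVneq y 0.
  exists 0 => i; have /andP[ai0 di0] := ad0 i.
  have /eqP := zy i; rewrite y0 expf_eq0 di0 => /eqP ->.
  by rewrite expr0n gtn_eqF.
have z0 i : z i != 0.
  apply: contra_neq y0 => zi0; rewrite -(zy i) zi0 expr0n gtn_eqF//.
  by case/andP: (ad0 i).
exists (\prod_k z k ^ c k) => i.
rewrite -[RHS]expr1z -ac expfz_sum// -prodrXl; apply: eq_bigr => k _.
suff zik : z k ^+ a i = z i ^+ a k.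
  by rewrite exprnP exprzAC mulrC -exprz_exp -!exprnP zik.
have [->//|ik] := eqVneq i k.
(* [d k] divides [e = a i * d i] and is coprime to [d i]. With [a i = g * d k] one gets
   [a k = g * d i], and both powers equal [y ^+ g]. *)
have /dvdnP[g ag] : (d k %| a i)%N.
  rewrite -(Gauss_dvdl _ (p := d i)) ?ade -?(ade k) ?dvdn_mull//.
  by rewrite coprime_sym cod.
have -> : a k = (g * d i)%N.
  have /andP[_ dk0] := ad0 k; apply/eqP.
  by rewrite -(eqn_pmul2r dk0) ade -(ade i) ag mulnAC.
by rewrite ag mulnC [(g * _)%N]mulnC !exprM !zy.
Qed.

End Bezout.

Lemma interpolate_powers (a b : nat) (z w : F) :
    (0 < a)%N -> (0 < b)%N -> coprime a b -> z ^+ (a * b) = w ^+ (a * b) ->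
  exists v, v ^+ a = z ^+ a /\ v ^+ b = w ^+ b.
Proof.
move=> a0 b0 cab zw; have [z0|z0] := eqVneq z 0.
  exists 0; move/esym/eqP: zw.
  rewrite z0 [X in _ == X]expr0n gtn_eqF ?muln_gt0 ?a0 ?b0// expf_eq0.
  by case/andP=> _ /eqP ->.
(* [t] is 1 modulo [a] and 0 modulo [b]. Multiplying [z] by the [t]-th power of the root of unity
   [w / z] therefore keeps the [a]-th power of [z] and turns its [b]-th power into that of [w]. *)
set t := chinese a b 1 0.
have rho : (w / z) ^+ (a * b) = 1 by rewrite expr_div_n -zw divff ?expf_neq0.
have /dvdnP[h th] : (b %| t)%N by rewrite /dvdn chinese_modr// mod0n.
exists (z * (w / z) ^+ t); split.
  rewrite exprMn -exprM th -mulnA [(b * a)%N]mulnC mulnC exprM rho expr1n.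
  by rewrite mulr1.
have tb : (t * b = b %[mod a * b])%N.
  rewrite -[X in _ = X %[mod _]]mul1n.
  rewrite [in LHS]mulnC [in RHS]mulnC [(a * b)%N]mulnC.
  by rewrite -!muln_modr chinese_modl.
rewrite exprMn -exprM -(expr_mod (t * b)%N rho) tb (expr_mod b rho) -exprMn.
by rewrite mulrC divfK.
Qed.

End Roots.

Local Open Scope quotient_scope.
Local Open Scope classical_set_scope.

Lemma homeomorphism_id (X : topologicalType) : homeomorphism (@id X).
Proof. by split=> [x|]; [|exists id; split=> // x]; exact: cvg_id. Qed.

(** * Limits and colimits recognised through compactness *)

Section Universal.
Variables (I : Type) (X : I -> topologicalType) (Y : topologicalType).

(** The factorization [u] is determined pointwise. It is continuous because each cluster point of
    [u @ z] has the same projections as [u z], hence equals it, and in a compact space a filter with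
    a single cluster point converges to it. *)
Lemma compact_is_limit (f : forall i, X i -> Y) (L : topologicalType)
    (pr : forall i, L -> X i) (pr0 : L -> Y) :
    compact [set: L] -> hausdorff_space L ->
    (forall i, hausdorff_space (X i)) -> hausdorff_space Y ->
    is_cone f pr pr0 ->
    (forall x y, (forall i, pr i x = pr i y) -> pr0 x = pr0 y -> x = y) ->
    (forall (x : forall i, X i) y, (forall i, f i (x i) = y) ->
      exists l, (forall i, pr i l = x i) /\ pr0 l = y) ->
  is_limit f pr pr0.
Proof.
move=> cptL hL hX hY prC inj surj; split=> // Z q q0 qC.
have /choice[u uP] : forall z, exists l,
    (forall i, pr i l = q i z) /\ pr0 l = q0 z.
  by move=> z; apply: surj => i; exact: (cone_comm qC).
exists u; split; last first.
  move=> v [_ vq vq0]; apply/funext => z; apply: inj => [i|].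
    by rewrite (uP z).1 -vq.
  by rewrite (uP z).2 -vq0.
split=> [z|i z|z]; [|exact: (uP z).1|exact: (uP z).2].
have cl (T : topologicalType) (g : L -> T) (h : Z -> T) y :
    hausdorff_space T -> continuous g -> continuous h -> g \o u =1 h ->
    cluster (u @ z) y -> g y = g (u z).
  move=> hT gc + /funext gh; rewrite -gh cluster_cvgE.
  move=> /(_ z) hc [G GF [Gy uG]].
  (* [G] refines [u @ z] and converges to [y], so its image under [g] converges both to [g y] and to
     [h z = g (u z)]. *)
  apply: (cvg_unique hT (F := g @ G)).
    by apply: cvg_trans (gc y); exact: cvg_app.
  by apply: cvg_trans hc => A; exact: (uG (g @^-1` A)).
have clu y : cluster (u @ z) y -> y = u z.
  move=> uy; apply: inj => [i|].
    apply: (cl _ (pr i) (q i)) uy => //.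
    - exact: (cone_cts prC).
    - exact: (cone_cts qC).
    - by move=> w; exact: (uP w).1.
  apply: (cl _ pr0 q0) uy => //.
  - exact: (cone_cts0 prC).
  - exact: (cone_cts0 qC).
  - by move=> w; exact: (uP w).2.
apply: (compact_cluster_set1 (V := [set: L])) => //.
- exact: filterT.
- exact: filterT.
rewrite eqEsubset; split=> [y /clu //|_ ->] /=.
have [y [_ uy]] := cptL (u @ z) _ filterT.
by rewrite -(clu y uy).
Qed.

(** The last hypothesis says that the fibres of [inj0] are generated by those of the maps [f i],
    phrased through functions constant on fibres. Continuity of the factorization holds because
    [inj0] is a closed map. *)
Lemma compact_is_colimit (f : forall i, Y -> X i) (C : topologicalType)
    (inj : forall i, X i -> C) (inj0 : Y -> C) :
    compact [set: Y] -> hausdorff_space C -> is_cocone f inj inj0 ->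
    (forall i x, exists y, f i y = x) -> (forall c, exists y, inj0 y = c) ->
    (forall (T : Type) (q0 : Y -> T),
      (forall i x y, f i x = f i y -> q0 x = q0 y) ->
      forall x y, inj0 x = inj0 y -> q0 x = q0 y) ->
  is_colimit f inj inj0.
Proof.
move=> cptY hC injC fs /choice[g gK] glue; split=> // Z q q0 qC.
have q0E x y : inj0 x = inj0 y -> q0 x = q0 y.
  apply: glue => i a b ab.
  by rewrite -(cocone_comm qC i) -(cocone_comm qC i b) /= ab.
have uE y : (q0 \o g) (inj0 y) = q0 y by apply: q0E; rewrite gK.
exists (q0 \o g); split; last first.
  by move=> v [_ _ v0]; apply/funext => c; rewrite -(gK c) uE -v0.
split=> [|i x|y]; last exact: uE.
  apply/continuous_closedP => A cA.
  have -> : (q0 \o g) @^-1` A = inj0 @` (q0 @^-1` A).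
    rewrite eqEsubset; split=> [c /= Ac|c [y /= Ay <-]] /=.
      by exists (g c).
    by rewrite -/((q0 \o g) _) uE.
  apply: compact_closed => //; apply: continuous_compact.
    by apply: continuous_subspaceT; exact: (cocone_cts0 injC).
  apply: subclosed_compact cptY _ => //.
  by apply: preimage_closed cA => y _; exact: (cocone_cts0 qC).
have [y <-] := fs i x.
have := cocone_comm injC i y; have := cocone_comm qC i y => /= -> ->.
by have /= := uE y.
Qed.

End Universal.

(** * Compact sets of complex numbers *)

Section ComplexPlane.
Variable R : realType.
Local Open Scope ring_scope.
Local Open Scope complex_scope.
Local Notation Re := complex.Re.
Local Notation Im := complex.Im.

Lemma real_complex_continuous : continuous (fun x : R => x%:C : CC R).
Proof.
move=> x; apply/cvgrPdist_lt => /= e e0.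
(* Positivity in the order of [CC R] forces a zero imaginary part. *)
have eE : e = (Re e)%:C.
  move: e0; rewrite /CC in e *; rewrite ltcE => /andP[/eqP] /=.
  by case: e => a b /= ->.
move: e0; rewrite eE => e0; have {}e0 : 0 < Re e by move: e0; rewrite ltcR.
near=> y.
rewrite -rmorphB /= normc_def /= expr0n addr0 sqrtr_sqr ltcR.
by near: y; exact: (@cvgr_dist_lt _ _ _ _ _ id x).
Unshelve. all: by end_near. Qed.

(** Heine-Borel for the plane: a disc lies in a square, the continuous image of a product of two
    real segments. *)
Lemma norm_le_compact (B : CC R) :
  exists K : set (CC R), compact K /\ forall x, `|x| <= B -> K x.
Proof.
pose M := Re (B : R[i]).
pose f (p : R * R) : CC R := p.1%:C + 'i%C * p.2%:C.
exists (f @` (`[- M, M]%classic `*` `[- M, M]%classic)); split.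
  apply: continuous_compact; last first.
    by apply: compact_setX; exact: segment_compact.
  apply: continuous_subspaceT => p; apply: (@cvgD (CC R) (CC R)).
    by apply: continuous_comp; [exact: cvg_fst|exact: real_complex_continuous].
  apply: (@cvgM (CC R)); first exact: cvg_cst.
  by apply: continuous_comp; [exact: cvg_snd|exact: real_complex_continuous].
move=> x xB; exists (Re (x : R[i]), Im (x : R[i])); last first.
  by rewrite /f /= -complexE.
have BE : B = M%:C.
  have : 0 <= B by exact: le_trans xB.
  by rewrite /M; case: (B) => a b; rewrite lecE /= => /andP[/eqP -> _].
split; rewrite /= in_itv /= -ler_norml -lecR -BE; apply: le_trans xB.
  exact: normc_ge_Re.
(* The imaginary part is, up to sign, the real part of [x] times ['i], which has the same modulus as
   [x]. *)
rewrite -normrN -ReiNIm; apply: le_trans (normc_ge_Re _) _.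
by rewrite normrM [X in _ * X]normc_def /= expr0n expr1n add0r sqrtr1 mulr1.
Qed.

End ComplexPlane.

Lemma compact_set_type (T : topologicalType) (A K : set T) :
  compact K -> K `<=` A -> compact (@set_val T A @^-1` K).
Proof.
move=> cK KA F PF FK; have [x [Kx Fx]] := cK (set_val @ F) _ FK.
exists (SigSub (mem_set (KA x Kx))).
split=> // U W FU [_ [[W' oW' <-] W'x W'W]].
have FU' : (set_val @ F) (set_val @` U).
  by apply: (@filterS _ F _ U) => // u Uu; exists u.
have [y [[u Uu <-] Wu]] := Fx _ W' FU' (open_nbhs_nbhs (conj oW' W'x)).
by exists u; split=> //; exact: W'W.
Qed.

(** * Weighted projective spaces are compact and Hausdorff *)

Section Wps.
Variables (R : realType) (n : nat).
Implicit Types chi omega : weight n.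
Local Open Scope ring_scope.
Local Notation V := (set_type (@nonzero_vectors R n)).

Lemma wps_classP omega (z w : V) :
  wps_class omega z = wps_class omega w <->
  exists2 l : CC R, l != 0 &
    forall j, set_val w 0 j = l ^+ omega j * set_val z 0 j.
Proof. by split=> [/eqquotP/asboolP|H]//; apply/eqquotP/asboolP. Qed.

Lemma wps_class_surj omega (x : wps R omega) : exists z, wps_class omega z = x.
Proof. by exists (repr x); exact: reprK. Qed.

Lemma vector_eq (z w : V) : (forall j, set_val z 0 j = set_val w 0 j) -> z = w.
Proof. by move=> zw; apply/val_inj/rowP. Qed.

Lemma vector_neq0 (z : V) : exists j, set_val z 0 j != 0.
Proof.
apply: contrapT => z0; have /= /eqP[] := set_valP z.
apply/rowP => j; rewrite mxE.
by apply/eqP/negPn/negP => zj; apply: z0; exists j.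
Qed.

Lemma row_nonzero (f : 'I_n.+1 -> CC R) :
  (exists j, f j != 0) -> \row_j f j \in @nonzero_vectors R n.
Proof.
move=> [j fj]; apply/mem_set; apply: contra_neq fj => /rowP/(_ j).
by rewrite !mxE.
Qed.

Lemma vector_of_row (f : 'I_n.+1 -> CC R) :
  (exists j, f j != 0) -> exists z : V, forall j, set_val z 0 j = f j.
Proof.
by move=> /row_nonzero f0; exists (SigSub f0) => j; rewrite set_valE /= mxE.
Qed.

Lemma coord_val_continuous j : continuous (fun z : V => set_val z 0 j : CC R).
Proof.
move=> z; apply: (@continuous_comp _ _ _ set_val (fun M : 'rV_n.+1 => M 0 j)).
  exact: initial_continuous.
exact: coord_continuous.
Qed.

Lemma coord_continuousP (T : topologicalType) (g : T -> V) :
  (forall j, continuous (fun t => set_val (g t) 0 j : CC R)) -> continuous g.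
Proof.
move=> gc; apply: continuous_comp_initial => t A [P Pt PA].
rewrite nbhs_simpl /=; near=> w; apply: PA => i j; rewrite !ord1.
move: i j; near: w; apply: filter_forall => i; apply: filter_forall => j.
by apply: gc; have := Pt i j; rewrite /= !ord1.
Unshelve. all: by end_near. Qed.

Lemma wps_class_continuous omega : continuous (@wps_class R n omega).
Proof. exact: pi_continuous. Qed.

Lemma wps_act_nonzero omega (l : {x : CC R | x != 0}) (z : V) :
  \row_j (sval l ^+ omega j * set_val z 0 j) \in @nonzero_vectors R n.
Proof.
apply: row_nonzero; have [j zj] := vector_neq0 z; exists j.
by rewrite mulf_neq0// expf_neq0//; exact: (svalP l).
Qed.

Definition wps_act omega l (z : V) : V := SigSub (wps_act_nonzero omega l z).

Lemma wps_actE omega l z j :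
  set_val (wps_act omega l z) 0 j = sval l ^+ omega j * set_val z 0 j.
Proof. by rewrite set_valE /= mxE. Qed.

Lemma wps_act_continuous omega l : continuous (wps_act omega l).
Proof.
apply: coord_continuousP => j.
under eq_fun do rewrite wps_actE.
move=> z; apply: (@continuousM (CC R) _ (fun=> sval l ^+ omega j)).
  exact: cst_continuous.
exact: coord_val_continuous.
Qed.

Lemma wps_class_act omega l z :
  wps_class omega (wps_act omega l z) = wps_class omega z.
Proof.
apply/esym/wps_classP; exists (sval l); first exact: (svalP l).
exact: wps_actE.
Qed.

(** The saturation of [A] is the union of its preimages under the scalars, each of which acts
    continuously. *)
Lemma wps_class_open omega (A : set V) :
  open A -> open (@wps_class R n omega @` A : set (wps R omega)).
Proof.
move=> oA; rewrite /open /= /quotient_open.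
have -> : \pi_(quotient_topology {eq_quot wps_equiv R omega}) @^-1`
    (@wps_class R n omega @` A) = \bigcup_l wps_act omega l @^-1` A.
  rewrite eqEsubset; split=> [w [v Av vw]|w [l _ Aw]].
    have /wps_classP[l l0 lw] : wps_class omega w = wps_class omega v.
      by rewrite vw.
    exists (exist _ l l0) => //=; rewrite (_ : wps_act _ _ _ = v)//.
    by apply: vector_eq => j; rewrite wps_actE lw.
  by exists (wps_act omega l w) => //; exact: wps_class_act.
apply: bigcup_open => l _; apply: open_comp oA => w _.
exact: wps_act_continuous.
Qed.

Lemma wps_class_nbhs omega (A : set V) (z : V) : nbhs z A ->
  nbhs (wps_class omega z : wps R omega) (@wps_class R n omega @` A).
Proof.
move=> zA; apply: (@filterS _ (nbhs (wps_class omega z : wps R omega)) _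
  (@wps_class R n omega @` interior A)).
  by apply: image_subset; exact: interior_subset.
apply: open_nbhs_nbhs; split; first exact/wps_class_open/open_interior.
by exists z.
Qed.

Lemma wps_hausdorff omega : hausdorff_space (wps R omega).
Proof.
move=> x y; have [z <-] := wps_class_surj x; have [w <-] := wps_class_surj y.
move=> zw; apply/wps_classP.
(* A cluster point of the scalars carrying points near z to points near w
   carries z to w. *)
pose B (AB : set V * set V) : set (CC R) := [set l | l != 0 /\ exists z' w',
  [/\ AB.1 z', AB.2 w' &
    forall j, set_val w' 0 j = l ^+ omega j * set_val z' 0 j]].
pose F := filter_from [set AB | nbhs z AB.1 /\ nbhs w AB.2] B.
have FF : ProperFilter F.
  apply: filter_from_proper.
    apply: filter_from_filter.
      by exists (setT, setT); split; exact: filterT.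
    move=> [A1 A2] [B1 B2] [/= z1 w1] [/= z2 w2].
    exists (A1 `&` B1, A2 `&` B2); first by split; exact: filterI.
    move=> l [l0 [z' [w' [[? ?] [? ?] lE]]]].
    by split; split=> //; exists z', w'.
  move=> [A1 A2] [/= /(@wps_class_nbhs omega _ _) zA].
  move=> /(@wps_class_nbhs omega _ _) wA.
  have [_ [[z' Az <-] [w' Aw /esym/wps_classP[l l0 lE]]]] := zw _ _ zA wA.
  by exists l; split=> //; exists z', w'.
have [j zj] := vector_neq0 z.
(* Near [z] and [w] the quotient bounds the modulus of [l ^+ omega j], hence that of [l] when it
   exceeds 1; the final summand covers the other scalars. *)
pose b : CC R := (`|set_val w 0 j| + 1) / (`|set_val z 0 j| / 2) + 1.
have [K [cK bK]] := norm_le_compact b.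
have FK : F K.
  exists ([set z' : V | `|set_val z 0 j| / 2 < `|set_val z' 0 j : CC R|],
          [set w' : V | `|set_val w' 0 j : CC R| < `|set_val w 0 j| + 1]).
    split=> /=.
      apply: (@cvgr_norm_gt (CC R) (CC R) _ _ _ _ _
        (@coord_val_continuous j z)).
      by rewrite ltr_pdivrMr// ltr_pMr ?normr_gt0// ltr1n.
    apply: (@cvgr_norm_lt (CC R) (CC R) _ _ _ _ _ (@coord_val_continuous j w)).
    by rewrite ltrDl.
  move=> l [l0 [z' [w' [/= zz' ww' lE]]]]; apply: bK.
  have c0 : 0 < (`|set_val w 0 j| + 1) / (`|set_val z 0 j| / 2) :> CC R.
    by rewrite !divr_gt0 ?normr_gt0// ltr_wpDl.
  have [l1|/ltW l1] := real_leP (normr_real l) (real1 (CC R)).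
    by apply: le_trans l1 _; rewrite lerDr ltW.
  apply: le_trans (_ : `|l| ^+ omega j <= _).
    by rewrite ler_eXnr// wt_gt0.
  rewrite ler_wpDr// ler_pdivlMr ?divr_gt0 ?normr_gt0//.
  apply: le_trans (ltW ww'); rewrite lE normrM normrX.
  by rewrite ler_wpM2l ?exprn_ge0// ltW.
have [l [Kl Fl]] := cK F FF FK.
have lE k : set_val w 0 k = l ^+ omega k * set_val z 0 k.
  (* [phi] vanishes on the triples that define [B]; were it nonzero at [(z, w, l)], it would be
     nonzero on a neighbourhood, which contains such a triple. *)
  pose phi (t : V * V * CC R) : CC R :=
    t.2 ^+ omega k * set_val t.1.1 0 k - set_val t.1.2 0 k.
  have phi_cts : continuous phi.
    move=> t; apply: (@cvgB (CC R) (CC R)).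
      apply: (@cvgM (CC R)).
        apply: (@continuous_comp _ _ _ snd (fun x : CC R => x ^+ omega k)).
          exact: cvg_snd.
        exact: exprn_cts.
      apply: (@continuous_comp _ _ _ (fun t : V * V * CC R => t.1.1)
        (fun v : V => set_val v 0 k : CC R)); last exact: coord_val_continuous.
      by apply: continuous_comp; [exact: cvg_fst|exact: cvg_fst].
    apply: (@continuous_comp _ _ _ (fun t : V * V * CC R => t.1.2)
        (fun v : V => set_val v 0 k : CC R)); last exact: coord_val_continuous.
    by apply: continuous_comp; [exact: cvg_fst|exact: cvg_snd].
  apply: contrapT => wlz.
  have /eqP : phi (z, w, l) <> 0 by move=> /eqP; rewrite subr_eq0 => /eqP/esym.
  move=> /(@cvgr_neq0 (CC R) (CC R) _ _ _ _ _ (phi_cts _)).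
  case=> -[/= A S] [[[A1 A2] [/= A1z A2w] AS] Sl] Aphi.
  have [||l' [[l'0 [z' [w' [A1z' A2w' l'E]]]] Sl']] := Fl (B (A1, A2)) S.
  - by exists (A1, A2).
  - by [].
  have /eqP[] : phi (z', w', l') != 0 by apply: Aphi; split=> //; exact: AS.
  by rewrite /phi /= l'E subrr.
(* A limit of nonzero scalars could be zero, but then [w] would vanish. *)
exists l => //; apply/eqP => l0; have [k /eqP[]] := vector_neq0 w.
by rewrite lE l0 expr0n gtn_eqF ?wt_gt0// mul0r.
Qed.

(** Take an [omega j]-th root of each coordinate and act by the inverse of the root of largest
    modulus. *)
Lemma wps_normalize omega (x : wps R omega) : exists2 z : V,
  wps_class omega z = x &
  (forall j, `|set_val z 0 j : CC R| <= 1) /\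
  exists j, `|set_val z 0 j : CC R| = 1.
Proof.
have [z <-] := wps_class_surj x; have [i0 zi0] := vector_neq0 z.
pose c j : CC R := (omega j).-root (set_val z 0 j).
have cE j : c j ^+ omega j = set_val z 0 j by rewrite rootCK ?wt_gt0.
have [i ci] : exists i, forall j, `|c j| <= `|c i|.
  have [i _ ci] := @arg_maxP _ _ _ i0 predT (fun j => complex.Re `|c j|) isT.
  exists i => j; rewrite lecE; apply/andP; split; last exact: (ci j isT).
  by rewrite !normc_def /=.
have ci0 : c i != 0.
  rewrite -normr_gt0; apply: lt_le_trans _ (ci i0); rewrite normr_gt0.
  by apply: contra_neq zi0 => c0; rewrite -cE c0 expr0n gtn_eqF ?wt_gt0.
have ciV : (c i)^-1 != 0 by rewrite invr_eq0.
pose l : {x : CC R | x != 0} := exist _ (c i)^-1 ciV.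
exists (wps_act omega l z); first exact: wps_class_act.
have aE j : set_val (wps_act omega l z) 0 j = (c j / c i) ^+ omega j.
  by rewrite wps_actE /= -cE -exprMn mulrC.
split=> [j|]; last by exists i; rewrite aE divff// expr1n normr1.
rewrite aE normrX exprn_ile1// normrM normfV ler_pdivrMr ?normr_gt0//.
by rewrite mul1r.
Qed.

(** Normalized representatives lie in finitely many compact sets [S j], on which coordinate [j] has
    modulus 1, so that they avoid the origin. *)
Lemma wps_compact omega : compact [set: wps R omega].
Proof.
have [K [cK K1]] := norm_le_compact (1 : CC R).
pose S j := [set M : 'rV[CC R]_n.+1 | forall i, K (M 0 i)] `&`
  [set M : 'rV[CC R]_n.+1 | `|M 0 j| = 1].
have cS j : compact (S j).
  apply: compact_closedI; last first.
    apply: (@preimage_closed _ _ (fun M : 'rV[CC R]_n.+1 => `|M 0 j|) [set 1]).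
      move=> M _.
      apply: (@continuous_comp _ _ _ (fun M : 'rV[CC R]_n.+1 => M 0 j)).
        exact: coord_continuous.
      exact: norm_continuous.
    apply: accessible_closed_set1.
    exact/hausdorff_accessible/norm_hausdorff.
  exact: (@rV_compact (CC R) _ (fun=> K)).
have SV j : S j `<=` @nonzero_vectors R n.
  move=> M [_ /= Mj]; apply: contra_eq_neq Mj => ->.
  by rewrite mxE normr0 eq_sym oner_neq0.
have -> : [set: wps R omega] =
    \bigcup_(j in [set` enum 'I_n.+1])
      (@wps_class R n omega @` (set_val @^-1` S j)).
  rewrite eqEsubset; split=> // x _; have [z <- [z1 [j zj]]] := wps_normalize x.
  exists j; first by rewrite /= mem_enum.
  by exists z => //; split=> //= i; exact/K1/z1.
rewrite bigcup_seq; apply: bigsetU_compact => j _; apply: continuous_compact.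
  by apply: continuous_subspaceT; exact: wps_class_continuous.
exact/compact_set_type.
Qed.

End Wps.

(** * Fibres and images of the maps e(chi/omega) *)

Section Maps.
Variables (R : realType) (n : nat).
Implicit Types chi omega tau : weight n.
Local Open Scope ring_scope.
Local Notation V := (set_type (@nonzero_vectors R n)).

Lemma wps_powE chi omega (z : V) j :
  set_val (wps_pow chi omega z) 0 j = set_val z 0 j ^+ wexp chi omega j.
Proof. by rewrite set_valE /= mxE. Qed.

(** The condition on exponents is a real one: e(1/sigma) after e(sigma) raises all coordinates to
    the power l(sigma), whereas e(1/1) is the identity. *)
Lemma wps_map_comp chi omega tau (x : wps R tau) :
    (forall j, wexp chi omega j * wexp omega tau j = wexp chi tau j)%N ->
  wps_map R chi omega (wps_map R omega tau x) = wps_map R chi tau x.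
Proof.
move=> chiE; have [z <-] := wps_class_surj x; rewrite !wps_mapE.
by congr wps_class; apply: vector_eq => j; rewrite !wps_powE -exprM mulnC chiE.
Qed.

Lemma wps_map_id chi (x : wps R chi) : wps_map R chi chi x = x.
Proof.
have [z <-] := wps_class_surj x; rewrite wps_mapE.
by congr wps_class; apply: vector_eq => j; rewrite wps_powE wexpxx expr1.
Qed.

Lemma wps_map_pcontent_wone p chi (x : wps R chi) :
  wps_map R (wone n) (pcontent p chi) (wps_map R (pcontent p chi) chi x) =
  wps_map R (wone n) chi x.
Proof. by apply: wps_map_comp => j; rewrite mulnC wexp_pcontentM. Qed.

Lemma wps_map_chi_pcontent p chi (x : wps R (wone n)) :
  wps_map R chi (pcontent p chi) (wps_map R (pcontent p chi) (wone n) x) =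
  wps_map R chi (wone n) x.
Proof.
apply: wps_map_comp => j.
by rewrite wexp_pcontent_r !wexp_one_r divnK ?pcontent_dvd.
Qed.

Lemma wps_map_wone_surj chi (x : wps R chi) :
  exists y, wps_map R chi (wone n) y = x.
Proof.
have [z <-] := wps_class_surj x.
have [|y yE] := @vector_of_row R n (fun j => (chi j).-root (set_val z 0 j)).
  have [j zj] := vector_neq0 z; exists j; apply: contra_neq zj => rj.
  by rewrite -(rootCK (wt_gt0 chi j) (set_val z 0 j)) rj expr0n gtn_eqF ?wt_gt0.
exists (wps_class (wone n) y); rewrite wps_mapE; congr wps_class.
by apply: vector_eq => j; rewrite wps_powE yE wexp_one_r rootCK ?wt_gt0.
Qed.

Section Contents.
(** The weights [om i] are contents only up to the equation [omE], so that one index can carry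
    [wone n] itself. *)
Variables (chi : weight n) (I : finType) (p : I -> nat) (om : I -> weight n).
Hypothesis omE : forall i, om i = pcontent (p i) chi.
Hypothesis p_inj : injective p.
Hypothesis s_coprime :
  forall q, prime q -> exists i, ~~ (q %| wscale (om i) chi)%N.

Lemma wps_map_contents_inj (x y : wps R chi) :
  (forall i, wps_map R (om i) chi x = wps_map R (om i) chi y) -> x = y.
Proof.
have [z <-] := wps_class_surj x; have [w <-] := wps_class_surj y => xy.
have [c cs] := bezout_family s_coprime.
have /choice[l lP] : forall i, exists l : CC R, l != 0 /\ forall j,
    set_val w 0 j ^+ wexp (om i) chi j =
    l ^+ om i j * set_val z 0 j ^+ wexp (om i) chi j.
  move=> i; have := xy i; rewrite !wps_mapE => /wps_classP[l l0 lE].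
  by exists l; split=> // j; have := lE j; rewrite !wps_powE.
(* Coprimality excludes an empty index set; the map at [i0] shows that [z] and [w] have the same
   zero coordinates. *)
have [i0 _] := s_coprime (isT : prime 2).
apply/wps_classP; exists (\prod_i l i ^ c i) => [|j].
  by apply/prodf_neq0 => i _; rewrite expfz_neq0// (lP i).1.
have [zj|zj] := eqVneq (set_val z 0 j) 0.
  rewrite zj mulr0; apply/eqP; have /eqP := (lP i0).2 j.
  rewrite zj [in X in _ * X]expr0n gtn_eqF ?wexp_gt0// mulr0.
  by rewrite expf_eq0 wexp_gt0.
have [wj|wj] := eqVneq (set_val w 0 j) 0.
  have /eqP := (lP i0).2 j; rewrite wj expr0n gtn_eqF ?wexp_gt0// eq_sym.
  by rewrite mulf_eq0 !expf_eq0 (negbTE zj) (negbTE (lP i0).1) !andbF.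
apply/(canRL (divfK zj))/(common_exponent cs) => [|i].
  by rewrite mulf_neq0 ?invr_eq0.
rewrite omE -(wexp_pcontent_cofactor _ _ j) exprM -omE.
rewrite expr_div_n (lP i).2 mulfK ?expf_neq0// -exprM.
by rewrite omE mulnC divnK ?pcontent_dvd.
Qed.

Lemma wps_map_contents_surj (x : forall i, wps R (om i)) (y : wps R (wone n)) :
    (forall i, wps_map R (wone n) (om i) (x i) = y) ->
  exists v, forall i, wps_map R (om i) chi v = x i.
Proof.
have [u <-] := wps_class_surj y => xu.
have [c cs] := bezout_family s_coprime.
have [i0 _] := s_coprime (isT : prime 2).
have /choice[z zP] : forall i, exists z : V, wps_class (om i) z = x i /\
    forall j, set_val z 0 j ^+ wexp (wone n) (om i) j = set_val u 0 j.
  move=> i; have [z zx] := wps_class_surj (x i).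
  have := xu i; rewrite -zx wps_mapE => /wps_classP[l l0 lE].
  (* Acting by a [t]-th root of [l] before e(1/[om i]) multiplies the image vector by [l], which
     makes it equal to [u] on the nose. *)
  pose t := wscale (wone n) (om i).
  have tl : t.-root l ^+ t = l by rewrite rootCK ?wscale_gt0.
  have r0 : t.-root l != 0.
    by apply: contra_neq l0 => r0; rewrite -tl r0 expr0n gtn_eqF ?wscale_gt0.
  pose r : {x : CC R | x != 0} := exist _ (t.-root l) r0.
  exists (wps_act (om i) r z); split=> [|j]; first exact: wps_class_act.
  rewrite wps_actE /= exprMn -exprM wexpK muln1 tl lE wps_powE.
  by rewrite expr1.
have /choice[v vP] : forall j, exists v : CC R, forall i,
    v ^+ wexp (om i) chi j = set_val (z i) 0 j.
  (* [k i] times the exponent of e([om i]/chi) is the scaling, so the [c i * k i] are Bezout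
     coefficients for the exponents at [j]. *)
  move=> j; pose k i := (chi j %/ om i j)%N.
  apply: (@common_root _ _ _ (fun i => c i * (k i)%:Z) _
    (fun i => wexp (wone n) (om i) j) (wexp (wone n) chi j) _ (set_val u 0 j)).
  - rewrite -[RHS]cs; apply: eq_bigr => i _; rewrite -mulrA -PoszM /k mulnC.
    by rewrite omE wexp_pcontent_cofactor.
  - exact: wexp_gt0.
  - by move=> i; rewrite omE wexp_pcontentM.
  - by move=> i h ih; rewrite !omE coprime_wexp_pcontent ?(inj_eq p_inj).
  - by move=> i; exact: (zP i).2.
have [|w wE] := @vector_of_row R n v.
  have [j zj] := vector_neq0 (z i0); exists j; apply: contra_neq zj => vj.
  by rewrite -(vP j i0) vj expr0n gtn_eqF ?wexp_gt0.
exists (wps_class chi w) => i; rewrite wps_mapE -(zP i).1; congr wps_class.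
by apply: vector_eq => j; rewrite wps_powE wE vP.
Qed.

End Contents.

Lemma wps_map_wone_glue chi (I : finType) (p : I -> nat) (T : Type)
    (q0 : wps R (wone n) -> T) :
    injective p ->
    (forall i x y, wps_map R (pcontent (p i) chi) (wone n) x =
                   wps_map R (pcontent (p i) chi) (wone n) y -> q0 x = q0 y) ->
    (forall j, chi j %| \prod_i pcontent (p i) chi j)%N ->
  forall x y, wps_map R chi (wone n) x = wps_map R chi (wone n) y ->
    q0 x = q0 y.
Proof.
move=> p_inj q0P chiP x y.
have [z <-] := wps_class_surj x; have [w <-] := wps_class_surj y.
(* Induction along the primes: the next vector [u] agrees with [z1] in the powers for the first
   prime, so [q0] does not change, and with [z2] in the powers for the remaining ones. *)
have step (r : seq I) (z1 z2 : V) : uniq r ->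
    (forall j, set_val z1 0 j ^+ (\prod_(i <- r) pcontent (p i) chi j) =
               set_val z2 0 j ^+ (\prod_(i <- r) pcontent (p i) chi j)) ->
    q0 (wps_class (wone n) z1) = q0 (wps_class (wone n) z2).
  elim: r z1 => [|i r IH] z1 /=.
    move=> _ zz; congr (q0 (wps_class _ _)); apply: vector_eq => j.
    by have := zz j; rewrite big_nil.
  move=> /andP[ir ur] zz.
  have /choice[v vP] : forall j, exists v : CC R,
      v ^+ pcontent (p i) chi j = set_val z1 0 j ^+ pcontent (p i) chi j /\
      v ^+ (\prod_(k <- r) pcontent (p k) chi j)%N =
      set_val z2 0 j ^+ (\prod_(k <- r) pcontent (p k) chi j)%N.
    move=> j; apply: interpolate_powers; last by have := zz j; rewrite big_cons.
    - exact: wt_gt0.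
    - by rewrite prodn_gt0// => k; exact: wt_gt0.
    rewrite pcontentE; apply: (@pnat_coprime (p i)); first exact: part_pnat.
    rewrite big_seq; elim/big_ind: _ => // [a b pa pb|k kr].
      by rewrite pnatM pa.
    rewrite pcontentE; apply: sub_in_pnat (part_pnat (p k) _) => q _.
    rewrite !inE => /eqP ->; rewrite (inj_eq p_inj).
    by apply: contraNneq ir => <-.
  have [|u uE] := @vector_of_row R n v.
    have [j zj] := vector_neq0 z1; exists j; apply: contra_neq zj => vj.
    apply/eqP; have /esym/eqP := (vP j).1.
    by rewrite vj expr0n gtn_eqF ?wt_gt0// expf_eq0 wt_gt0.
  transitivity (q0 (wps_class (wone n) u)).
    apply: (q0P i); rewrite !wps_mapE; congr wps_class; apply: vector_eq => j.
    by rewrite !wps_powE !wexp_one_r uE (vP j).1.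
  by apply: IH => // j; rewrite uE (vP j).2.
rewrite !wps_mapE => /wps_classP[l l0 lE].
have {}l0 : l != 0 :> CC R := l0.
pose a : {x : CC R | x != 0} := exist _ l l0.
(* Replacing [z] by [l] times [z] turns equality of classes into equality of the coordinate
   powers. *)
rewrite -(wps_class_act (wone n) a z).
apply: (step (index_enum I)) => [|j]; first exact: index_enum_uniq.
have /dvdnP[k ->] := chiP j; rewrite mulnC !exprM; congr (_ ^+ _).
by have := lE j; rewrite !wps_powE wexp_one_r wps_actE expr1 exprMn.
Qed.

End Maps.

(** * Assembly of the limit and colimit statements *)

Unset Implicit Arguments.

Theorem theorem4p9 (R : realType) (n : nat) (chi : weight n)
    (m : nat) (p : 'I_m -> nat)
    (p_inj : injective p) (pE : range p = weight_primes chi) :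
  (exists (L : topologicalType)
      (pr : forall i : 'I_m, L -> wps R (pcontent (p i) chi))
      (pr0 : L -> wps R (wone n)) (h : wps R chi -> L),
    [/\ is_limit (fun i => wps_map R (wone n) (pcontent (p i) chi)) pr pr0,
        homeomorphism h &
        forall i, pr i \o h =1 wps_map R (pcontent (p i) chi) chi])
  /\
  (exists (C : topologicalType)
      (inj : forall i : 'I_m, wps R (pcontent (p i) chi) -> C)
      (inj0 : wps R (wone n) -> C) (h : C -> wps R chi),
    [/\ is_colimit (fun i => wps_map R (pcontent (p i) chi) (wone n)) inj inj0,
        homeomorphism h &
        forall i, h \o inj i =1 wps_map R chi (pcontent (p i) chi)]).
Proof.
have p_prime i : prime (p i).
  by have : weight_primes chi (p i); [rewrite -pE; exists i|case].
split.
- exists (wps R chi), (fun i => wps_map R (pcontent (p i) chi) chi).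
  exists (wps_map R (wone n) chi), id; split=> //; last exact: homeomorphism_id.
  pose p' := oapp p 1%N.
  (* wone n is the 1-content of chi: the index None is the vertex CP^n. *)
  pose om (o : option 'I_m) :=
    if o is Some i then pcontent (p i) chi else wone n.
  have omE o : om o = pcontent (p' o) chi by case: o => //=; rewrite pcontent1.
  have p'_inj : injective p'.
    move=> [i|] [k|] //= => [/p_inj -> //|ip|ip].
      by have := p_prime i; rewrite ip.
    by have := p_prime k; rewrite -ip.
  have s_coprime q : prime q -> exists o, ~~ (q %| wscale (om o) chi)%N.
    move=> q_pr.
    (* A prime dividing l(chi) divides some weight, so it is one of the [p i], and the scaling at
       that index is prime to it. *)
    have [qL|qL] := boolP (q %| wscale (wone n) chi)%N; last by exists None.
    have [j qj] := prime_dvd_wscale_wone q_pr qL.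
    have [i _ iq] : range p q by rewrite pE; split=> //; exists j.
    by exists (Some i); rewrite -iq prime_ndvd_wscale_pcontent.
  apply: compact_is_limit.
  + exact: wps_compact.
  + exact: wps_hausdorff.
  + by move=> i; exact: wps_hausdorff.
  + exact: wps_hausdorff.
  + split=> [i||i x /=]; [exact: wps_map_continuous|exact: wps_map_continuous|].
    exact: wps_map_pcontent_wone.
  + move=> x y xy xy0; apply: (wps_map_contents_inj omE s_coprime).
    by case=> [i|]; [exact: xy|exact: xy0].
  + move=> x y xy.
    pose x' o : wps R (om o) := if o is Some i then x i else y.
    have [|v vP] :=
      wps_map_contents_surj omE p'_inj s_coprime (x := x') (y := y).
      by case=> [i|]; [exact: xy|exact: wps_map_id].
    by exists v; split=> [i|]; [exact: (vP (Some i))|exact: (vP None)].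
- exists (wps R chi), (fun i => wps_map R chi (pcontent (p i) chi)).
  exists (wps_map R chi (wone n)), id; split=> //; last exact: homeomorphism_id.
  apply: compact_is_colimit.
  + exact: wps_compact.
  + exact: wps_hausdorff.
  + split=> [i||i x /=]; [exact: wps_map_continuous|exact: wps_map_continuous|].
    exact: wps_map_chi_pcontent.
  + by move=> i x; exact: wps_map_wone_surj.
  + exact: wps_map_wone_surj.
  + move=> T q0 q0P; apply: (wps_map_wone_glue p_inj q0P) => j.
    (* Divisibility is tested on the [q]-part for each prime [q] dividing [chi j]; that part is one
       of the factors. *)
    apply/dvdn_partP => [|q]; first exact: wt_gt0.
    rewrite mem_primes => /and3P[q_pr _ qj].
    have [i _ <-] : range p q by rewrite pE; split=> //; exists j.
    by rewrite (bigD1 i)// -pcontentE dvdn_mulr.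
Qed.
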